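(* Let $k>1$ be an integer and let $d=k^{2}-1$. Then the fundamental solution of the equation $x^{2}-dy^{2}=1$ is $$x_{1}+y_{1}\sqrt{d}=k+\sqrt{d}.$$
   Context: For a positive integer $d$ that is not a perfect square and a nonzero integer $N$, a pair $(a,b)$ of integers with $a^{2}-db^{2}=N$ is identified with $a+b\sqrt{d}$ and called a solution of $x^{2}-dy^{2}=N$; it is positive if $a>0$ and $b>0$. The fundamental solution of $x^{2}-dy^{2}=N$ is the positive solution $x_{1}+y_{1}\sqrt{d}$ such that $x_{1}+y_{1}\sqrt{d}<x_{2}+y_{2}\sqrt{d}$ for every other positive solution $x_{2}+y_{2}\sqrt{d}$ of the same equation. *)

(* Defs.v *)
From Stdlib Require Export ZArith Reals.

Open Scope Z_scope.

(* The equation x^2 - d y^2 = N is considered only for a positive nonsquare d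
   and a nonzero N. *)
Definition pell_parameters (d N : Z) : Prop :=
  0 < d /\ ~ (exists m : Z, d = m ^ 2) /\ N <> 0.

Definition is_solution (d N a b : Z) : Prop := a ^ 2 - d * b ^ 2 = N.

Definition is_positive_solution (d N a b : Z) : Prop :=
  is_solution d N a b /\ 0 < a /\ 0 < b.

(* The real number a + b sqrt d with which the pair (a, b) is identified; the
   identification is injective since d is not a square. *)
Definition surd (d a b : Z) : R := (IZR a + IZR b * sqrt (IZR d))%R.

Definition is_fundamental_solution (d N a b : Z) : Prop :=
  pell_parameters d N /\
  is_positive_solution d N a b /\
  forall a' b' : Z,
    is_positive_solution d N a' b' -> (a', b') <> (a, b) ->
    (surd d a b < surd d a' b')%R.

(* Main.v *)
Require Import Defs.
From Stdlib Require Import ZArith Reals.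
From Stdlib Require Import Lia.
Open Scope Z_scope.

(** On the branch of a Pell conic in the first quadrant, [a] increases with
    [b], so a positive solution with [b = 1] minimises both coordinates, and
    hence [a + b sqrt d], among all positive solutions.  For [d = k^2 - 1] the
    pair [(k, 1)] is such a solution, since [k^2 - d = 1].  The parameter [d]
    is admissible because it lies strictly between the consecutive squares
    [(k - 1)^2] and [k^2]. *)

Lemma pred_square_nonsquare (k : Z) :
  1 < k -> ~ (exists m : Z, k ^ 2 - 1 = m ^ 2).
Proof.
  intros hk [m hm].
  (* The sign of [m] is irrelevant, and only [|m|] can be squeezed. *)
  rewrite (Z.pow_even_abs m 2) in hm by (exists 1; reflexivity).
  assert (k - 1 < Z.abs m) by nia.
  assert (Z.abs m < k) by nia.
  lia.
Qed.

(** The hyperbola is the graph of an increasing function of [b]: from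
    [a^2 - a'^2 = d (b^2 - b'^2)] the first coordinates of two positive
    solutions compare as the second ones do. *)
Lemma positive_solution_lt (d N a b a' b' : Z) :
  0 < d -> is_positive_solution d N a b -> is_positive_solution d N a' b' ->
  b < b' -> a < a'.
Proof.
  unfold is_positive_solution, is_solution.
  intros hd [h [ha hb]] [h' [ha' hb']] hlt.
  assert (b ^ 2 < b' ^ 2) by nia.
  assert (a ^ 2 < a' ^ 2) by nia.
  nia.
Qed.

Lemma positive_solution_inj (d N a a' b : Z) :
  is_positive_solution d N a b -> is_positive_solution d N a' b -> a = a'.
Proof.
  unfold is_positive_solution, is_solution.
  intros [h [ha hb]] [h' [ha' _]].
  assert (a ^ 2 = a' ^ 2) by lia.
  nia.
Qed.

Lemma surd_lt (d a b a' b' : Z) :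
  a < a' -> b <= b' -> (surd d a b < surd d a' b')%R.
Proof.
  intros ha hb. unfold surd.
  apply Rplus_lt_le_compat.
  - now apply IZR_lt.
  - apply Rmult_le_compat_r; [apply sqrt_pos | now apply IZR_le].
Qed.

(** [1] is the least value that the second coordinate of a positive solution
    can take, so a solution attaining it is the fundamental one. *)
Lemma fundamental_of_snd_1 (d N a : Z) :
  pell_parameters d N -> is_positive_solution d N a 1 ->
  is_fundamental_solution d N a 1.
Proof.
  intros hp hs. split; [exact hp | split; [exact hs |]].
  intros a' b' hs' hne.
  assert (0 < b') by apply hs'.
  assert (b' <> 1).
  { intros ->. apply hne. f_equal.
    exact (positive_solution_inj d N a' a 1 hs' hs). }
  apply surd_lt; [| lia].
  apply (positive_solution_lt d N a 1 a' b'); [apply hp | assumption.. | lia].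
Qed.

Theorem corollary7 (k d : Z) (hk : 1 < k) (hd : d = k ^ 2 - 1) :
  is_fundamental_solution d 1 k 1.
Proof.
  subst d. apply fundamental_of_snd_1.
  - split; [nia | split; [now apply pred_square_nonsquare | lia]].
  - unfold is_positive_solution, is_solution. lia.
Qed.
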